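(* Let $L_{n-d}$ be a linear subspace of $\mathbb{R}^n$ of codimension $d$ ($d\le n-1$) in general position with respect to one of the reflection arrangements $\mathcal{A}(A_{n-1})$, $\mathcal{A}(B_n)$, $\mathcal{A}(D_n)$. Then the number of regions of this arrangement intersected by $L_{n-d}$ equals, respectively, $$2\left(\left[{n\atop d+1}\right]+\left[{n\atop d+3}\right]+\dots\right),\quad 2\big(B(n,d+1)+B(n,d+3)+\dots\big),\quad 2\big(D(n,d+1)+D(n,d+3)+\dots\big).$$
   Context: $\mathcal{A}(A_{n-1})$ consists of the hyperplanes $x_i=x_j$ ($1\le i<j\le n$) in $\mathbb{R}^n$; $\mathcal{A}(B_n)$ of the hyperplanes $x_i=x_j$, $x_i=-x_j$ ($1\le i<j\le n$) and $x_k=0$ ($1\le k\le n$); $\mathcal{A}(D_n)$ of the hyperplanes $x_i=x_j$, $x_i=-x_j$ ($1\le i<j\le n$). Regions of an arrangement are the connected components of the complement of the union of its hyperplanes. For an arrangement $\mathcal{A}$ and $\mathcal{B}\subset\mathcal{A}$, $\mathrm{rank}(\mathcal{B})=n-\dim\bigcap_{H\in\mathcal{B}}H$. A linear subspace $L_{n-d}$ of codimension $d\le n-1$ is in general position w.r.t. $\mathcal{A}$ if for every nonempty $\mathcal{B}\subset\mathcal{A}$, $\dim\bigcap_{H\in\mathcal{B}}(H\cap L_{n-d})$ equals $n-d-\mathrm{rank}(\mathcal{B})$ if $\mathrm{rank}(\mathcal{B})\le n-d$ and $0$ otherwise. The numbers are defined by $t(t+1)\cdots(t+n-1)=\sum_k\left[{n\atop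 k}\right]t^k$, $(t+1)(t+3)\cdots(t+2n-1)=\sum_kB(n,k)t^k$, $(t+1)(t+3)\cdots(t+2n-3)(t+n-1)=\sum_kD(n,k)t^k$, all set to $0$ outside the range of exponents of the respective polynomial.
   Formalization: For the arrangements A(A_{n-1}) and A(D_n) the formal theorem assumes n ≥ 2; for n = 1 these arrangements are empty, so there is one region while the formula gives 2. *)

(* Defs.v *)
From HB Require Import structures.
From mathcomp Require Import all_boot all_order all_algebra.
From mathcomp Require Import all_classical all_reals all_analysis.
Set Implicit Arguments. Unset Strict Implicit. Unset Printing Implicit Defensive.
Import Order.TTheory GRing.Theory Num.Theory.
Import numFieldNormedType.Exports.
Local Open Scope ring_scope.

Definition hypmx (R : realType) n (a : 'rV[R]_n) : 'M[R]_n := kermx a^T.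
Definition hypset (R : realType) n (a : 'rV[R]_n) : set 'rV[R]_n :=
  [set x | (x <= hypmx a)%MS].

Definition evec (R : realType) n (i : 'I_n) : 'rV[R]_n := delta_mx 0 i.

(** Reflection arrangements, as lists of normal vectors. *)
Definition arrA (R : realType) n : seq 'rV[R]_n :=
  [seq evec R i - evec R j | i : 'I_n <- enum 'I_n, j : 'I_n <- seq.filter (fun j : 'I_n => (i < j)%N) (enum 'I_n)].
Definition arrD (R : realType) n : seq 'rV[R]_n :=
  arrA R n ++ [seq evec R i + evec R j | i : 'I_n <- enum 'I_n, j : 'I_n <- seq.filter (fun j : 'I_n => (i < j)%N) (enum 'I_n)].
Definition arrB (R : realType) n : seq 'rV[R]_n :=
  arrD R n ++ [seq evec R k | k <- enum 'I_n].

Definition capmx_sub (R : realType) n (A : seq 'rV[R]_n) (B : {set 'I_(size A)}) : 'M[R]_n :=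
  (\bigcap_(i in B) hypmx (tnth (in_tuple A) i))%MS.

Definition arr_rank (R : realType) n (A : seq 'rV[R]_n) (B : {set 'I_(size A)}) : nat :=
  (n - \rank (capmx_sub B))%N.

Definition general_position (R : realType) n (A : seq 'rV[R]_n) (d : nat) (L : 'M[R]_n) :=
  forall B : {set 'I_(size A)}, B != finset.set0 ->
    \rank (L :&: capmx_sub B)%MS =
      (if (arr_rank B <= n - d)%N then (n - d - arr_rank B)%N else 0%N).

Definition arr_complement (R : realType) n (A : seq 'rV[R]_n) : set 'rV[R]_n :=
  [set x | forall a, a \in A -> ~ hypset a x].

Definition regions (R : realType) n (A : seq 'rV[R]_n) : set (set 'rV[R]_n) :=
  [set C | exists2 x, arr_complement A x & C = connected_component (arr_complement A) x].

Definition regions_hit (R : realType) n (A : seq 'rV[R]_n) (L : 'M[R]_n) : set (set 'rV[R]_n) :=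
  [set C | regions A C /\ exists x, C x /\ (x <= L)%MS].

Definition stirling1 (n k : nat) : nat :=
  nth 0%N (\prod_(i < n) ('X + (i%:R)%:P) : {poly nat})%R k.
Definition Bnum (n k : nat) : nat :=
  nth 0%N (\prod_(i < n) ('X + ((2 * i).+1)%:R%:P) : {poly nat})%R k.
Definition Dnum (n k : nat) : nat :=
  nth 0%N ((\prod_(i < n.-1) ('X + ((2 * i).+1)%:R%:P)) * ('X + (n.-1)%:R%:P) : {poly nat})%R k.

(** c(d+1) + c(d+3) + ... (terms beyond the degree vanish). *)
Definition alt_tail (c : nat -> nat) (n d : nat) : nat :=
  \sum_(j < n) c (d + 1 + 2 * j)%N.

(* Main.v *)
(* A region meets L exactly when its sign pattern is realized on L, and deletion and
   restriction give Whitney's formula for the number of patterns: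
   (-1)^(n-d) sum_B (-1)^|B| (-1)^rank(L /\ B^perp).  General position replaces
   rank(L /\ B^perp) by max(rank(B^perp) - d, 0), so the number is a linear functional
   of the characteristic polynomial chi(t) = sum_B (-1)^|B| t^rank(B^perp).  Counting
   points over F_p for large primes p shows that chi is the product of the t - c_i, where
   the t + c_i are the factors in the statement, and chi(1) = 0 turns the functional
   into the alternating tail. *)
Require Import Defs.
From HB Require Import structures.
From mathcomp Require Import all_boot all_order all_algebra.
From mathcomp Require Import all_classical all_reals all_analysis.
From mathcomp Require Import mxabelem zify ring lra.
Import Order.TTheory GRing.Theory Num.Theory.
Import numFieldNormedType.Exports.
Local Open Scope ring_scope.
Local Open Scope classical_set_scope.

Set Implicit Arguments.
Unset Strict Implicit.
Unset Printing Implicit Defensive.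

(** * Inclusion-exclusion sums over sublists *)

(* Unfolded: the sum of (-1)^|B| g(B ++ s) over the sublists B of A. *)
Fixpoint incl_excl (T : Type) (V : zmodType) (g : seq T -> V) (A s : seq T) : V :=
  if A is a :: A' then incl_excl g A' s - incl_excl g A' (a :: s) else g s.

(** Only lists with entries in [U] occur as arguments. With [U] the arrangement itself, this lets
    general position be applied under the sum. *)
Lemma eq_in_incl_excl (T : eqType) (V : zmodType) (g h : seq T -> V) (A s U : seq T) :
    {subset A <= U} -> {subset s <= U} ->
    (forall u : seq T, {subset u <= U} -> g u = h u) ->
  incl_excl g A s = incl_excl h A s.
Proof.
move=> AU sU gh; elim: A s AU sU => [|a A IH] s AU sU /=; first exact: gh.
have aU : a \in U by apply: AU; rewrite mem_head.
have AU' : {subset A <= U} by move=> x xA; apply: AU; rewrite inE xA orbT.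
by rewrite !IH// => x; rewrite inE => /orP[/eqP->//|/sU].
Qed.

Lemma incl_excl_map (T1 T2 : Type) (V : zmodType) (f : T1 -> T2)
    (g : seq T2 -> V) (A s : seq T1) :
  incl_excl g (map f A) (map f s) = incl_excl (g \o map f) A s.
Proof. by elim: A s => [|a A IH] s //=; rewrite -map_cons !IH. Qed.

Lemma eq_incl_excl (T : Type) (V : zmodType) (g h : seq T -> V) (A s : seq T) :
  g =1 h -> incl_excl g A s = incl_excl h A s.
Proof. by move=> gh; elim: A s => [|a A IH] s /=; rewrite ?gh ?IH. Qed.

Lemma morph_incl_excl (T : Type) (V W : zmodType) (f : V -> W)
    (g : seq T -> V) (A s : seq T) : {morph f : x y / x - y} ->
  f (incl_excl g A s) = incl_excl (f \o g) A s.
Proof. by move=> fB; elim: A s => [|a A IH] s //=; rewrite fB !IH. Qed.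

(** * Ranks of intersections of hyperplanes, over the reals and modulo large primes *)

Definition capker (F : fieldType) n (s : seq 'rV[F]_n) : 'M[F]_n :=
  (\bigcap_(a <- s) kermx a^T)%MS.

Lemma sub_capker (F : fieldType) n (s : seq 'rV[F]_n) (m : nat) (X : 'M[F]_(m, n)) :
  (X <= capker s)%MS = all (fun a => X *m a^T == 0) s.
Proof.
elim: s => [|a s IH]; first by rewrite /capker big_nil submx1.
by rewrite /capker big_cons sub_capmx IH sub_kermx.
Qed.

Lemma capker_cons (F : fieldType) n (a : 'rV[F]_n) (s : seq 'rV[F]_n) :
  capker (a :: s) = (kermx a^T :&: capker s)%MS.
Proof. by rewrite /capker big_cons. Qed.

(** The normals become columns, so that an intersection of hyperplanes is the kernel of one matrix,
    defined over the integers for the arrangements at hand. *)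
Definition stack (R : nzRingType) n (s : seq 'rV[R]_n) : 'M[R]_(n, size s) :=
  \matrix_(i, j) (tnth (in_tuple s) j) 0 i.

Lemma capker_map (R : nzRingType) (F : fieldType) (f : {rmorphism R -> F}) n
    (s : seq 'rV[R]_n) :
  (capker [seq map_mx f a | a <- s] :=: kermx (map_mx f (stack s)))%MS.
Proof.
apply/eqmxP/rV_eqP => x; rewrite sub_capker sub_kermx all_map.
apply/allP/eqP => [h|h a].
  apply/matrixP => i j; rewrite ord1 [RHS]mxE.
  have /eqP/matrixP/(_ 0 0) := h _ (mem_tnth j (in_tuple s)).
  rewrite [RHS]mxE => <-; rewrite !mxE; apply: eq_bigr => k _; by rewrite !mxE.
move=> /(tnthP (in_tuple s))[j ->] /=; apply/eqP/matrixP => i k; rewrite !ord1.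
move/matrixP: h => /(_ 0 j); rewrite [RHS]mxE => E; rewrite [RHS]mxE -{}E.
by rewrite !mxE; apply: eq_bigr => l _; rewrite !mxE.
Qed.

Lemma rank_Smith (F : fieldType) m n (d : seq int) (r : nat) :
    (forall i, (i < r)%N -> (d`_i)%:~R != 0 :> F) ->
    (forall i, (r <= i)%N -> (i < size d)%N -> (d`_i)%:~R = 0 :> F) ->
  \rank (map_mx intr (\matrix_(i < m, j < n) (d`_i *+ (i == j :> nat))) : 'M[F]_(m, n))
    = minn r (minn m n).
Proof.
move=> d_lt d_ge.
(* From index [r] on, the entries of [u] are set to 1 to make [diag_mx u] invertible; [pid_mx]
   discards those rows. *)
pose u : 'rV[F]_m := \row_i (if (i < r)%N then (d`_i)%:~R else 1).
have -> : map_mx intr (\matrix_(i < m, j < n) (d`_i *+ (i == j :> nat))) =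
    diag_mx u *m pid_mx (minn r (minn m n)).
  apply/matrixP => i j; rewrite mul_diag_mx !mxE.
  case: (eqVneq (i : nat) j) => [ij|ij]; last by rewrite mulr0n mulr0.
  rewrite mulr1n !leq_min ltn_ord ij ltn_ord !andbT.
  case: ltnP => [_|ri]; first by rewrite mulr1.
  rewrite mulr0; have [/d_ge-> //|si] := ltnP j (size d).
  by rewrite nth_default.
have rm : (minn r (minn m n) <= m)%N by rewrite (leq_trans (geq_minr _ _)) ?geq_minl.
have rn : (minn r (minn m n) <= n)%N by rewrite (leq_trans (geq_minr _ _)) ?geq_minr.
rewrite eqmxMfull ?rank_pid_mx //.
rewrite row_full_unit unitmxE det_diag unitfE prodf_seq_neq0.
by apply/allP => i _ /=; rewrite mxE; case: ifP => [/d_lt//|_]; rewrite oner_eq0.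
Qed.

(** The transition matrices of the Smith form have unit determinant and stay invertible over [F];
    the nonzero invariant factors survive in [F] once [N] bounds them. The condition on [F] holds
    both in characteristic 0 and in large prime characteristic. *)
Lemma rank_map_int m n (M : 'M[int]_(m, n)) :
  exists r N : nat, forall F : fieldType,
    (forall z : int, z != 0 -> (`|z| <= N)%N -> z%:~R != 0 :> F) ->
    \rank (map_mx intr M : 'M[F]_(m, n)) = r.
Proof.
have [P Pu [Q Qu [d d_sorted ->]]] := int_Smith_normal_form M.
pose r := find (pred1 0) d; exists (minn r (minn m n)), (\max_(z <- d) `|z|%N)%N.
move=> F FN; rewrite !map_mxM.
have mapu k (X : 'M[int]_k) : X \in unitmx -> (map_mx intr X : 'M[F]_k) \in unitmx.
  by rewrite !unitmxE det_map_mx; apply: rmorph_unit.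
rewrite mxrankMfree ?row_free_unit ?mapu // eqmxMfull ?row_full_unit ?mapu //.
apply: rank_Smith => i ri.
  have isz : (i < size d)%N by rewrite (leq_trans ri) ?find_size.
  apply: FN; first by have := before_find 0 ri => /= ->.
  by apply: leq_bigmax_seq => //; apply: mem_nth.
(* The first zero divides every later invariant factor, so all of these vanish. *)
move=> isz; have dr0 : d`_r = 0.
  have := @nth_find _ 0 (pred1 0) d.
  by rewrite has_find => /(_ (leq_ltn_trans ri isz))/eqP.
have : (d`_r %| d`_i)%Z.
  apply: (sorted_leq_nth _ _ 0 d_sorted) => //; [exact: dvdz_trans|exact: dvdzz|].
  by rewrite inE (leq_ltn_trans ri).
by rewrite dr0 dvd0z => /eqP->.
Qed.

Lemma intr_Fp_neq0 p (z : int) : prime p -> z != 0 -> (`|z| < p)%N -> z%:~R != 0 :> 'F_p.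
Proof.
move=> p_pr z0 zp.
have nz : (`|z|%N)%:R != 0 :> 'F_p.
  rewrite -(dvdn_pcharf (pchar_Fp p_pr)); apply: contraL zp => /dvdn_leq.
  by rewrite absz_gt0 z0 => /(_ isT); rewrite -leqNgt.
by rewrite [z]intEsign intrM mulf_neq0 // rmorph_sign signr_eq0.
Qed.

Lemma rank_capker_Fp (R : numFieldType) n (s : seq 'rV[int]_n) :
  exists N : nat, forall p, prime p -> (N < p)%N ->
    \rank (capker [seq map_mx (intr : int -> 'F_p) a | a <- s]) =
    \rank (capker [seq map_mx (intr : int -> R) a | a <- s]).
Proof.
have [r [N rN]] := rank_map_int (stack s); exists N => p p_pr Np.
rewrite !capker_map !mxrank_ker !rN // => z z0 zN; first by rewrite intr_eq0.
by rewrite intr_Fp_neq0 // (leq_ltn_trans zN).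
Qed.

(** * The finite field method *)

Definition avoids (F : fieldType) n (A : seq 'rV[F]_n) (x : 'rV[F]_n) : bool :=
  all (fun a => x *m a^T != 0) A.

(** Splitting the points by whether they lie on the hyperplane of [a] gives exactly the recursion of
    [incl_excl]; a subspace of rank k has |F|^k points. *)
Lemma card_avoids (F : finFieldType) n (A s : seq 'rV[F]_n) :
  (#|[pred x : 'rV[F]_n | (x <= capker s)%MS && avoids A x]|%:Z =
  incl_excl (fun u => (#|F| ^ \rank (capker u))%N%:Z) A s)%R.
Proof.
elim: A s => [|a A IH] s /=.
  congr (_%:Z); rewrite -card_rowg; apply: eq_card => x.
  by rewrite mem_rowg inE andbT.
rewrite -!IH; set P := [pred x : 'rV[F]_n | (x <= capker s)%MS && avoids A x].
have -> : #|P| = (#|[pred x : 'rV[F]_n | (x <= capker s)%MS && avoids (a :: A) x]| +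
    #|[pred x : 'rV[F]_n | (x <= capker (a :: s))%MS && avoids A x]|)%N.
  rewrite -(cardID [pred x : 'rV[F]_n | x *m a^T != 0] P); congr (_ + _)%N.
    by apply: eq_card => x; rewrite !inE /=; case: eqVneq; rewrite ?andbF ?andbT.
  by apply: eq_card => x; rewrite !inE /= !sub_capker /=; case: eqVneq.
by rewrite PoszD addrK.
Qed.

Definition charpoly (R : numFieldType) n (A : seq 'rV[int]_n) : {poly int} :=
  incl_excl (fun u => 'X^(\rank (capker [seq map_mx (intr : int -> R) a | a <- u]))) A [::].

(* The finite field method: an integer matrix has the same rank over R and over F_p
   for large p (Smith normal form), so chi(p) counts points over F_p. *)
Lemma horner_charpoly (R : numFieldType) n (A : seq 'rV[int]_n) :
  exists N : nat, forall p, prime p -> (N < p)%N ->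
    (charpoly R A).[p%:Z] =
    #|[pred x : 'rV['F_p]_n | avoids [seq map_mx (intr : int -> 'F_p) a | a <- A] x]|%:Z.
Proof.
pose gR p (u : seq 'rV[int]_n) :=
  (p ^ \rank (capker [seq map_mx (intr : int -> R) a | a <- u]))%N%:Z.
pose gF p (u : seq 'rV[int]_n) :=
  (p ^ \rank (capker [seq map_mx (intr : int -> 'F_p) a | a <- u]))%N%:Z.
(* Each sublist has its own threshold; the maximum of these finitely many serves for all. *)
have [N NP] : exists N, forall p, prime p -> (N < p)%N ->
    incl_excl (gR p) A [::] = incl_excl (gF p) A [::].
  elim: A [::] => [|a A IH] s /=.
    by have [N NP] := rank_capker_Fp R s; exists N => p pp pN; rewrite /gR /gF NP.
  have [[N1 H1] [N2 H2]] := (IH s, IH (a :: s)); exists (maxn N1 N2) => p pp.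
  by rewrite gtn_max => /andP[p1 p2]; rewrite H1 ?H2.
exists N => p p_pr pN; rewrite -[LHS]/(horner_eval p%:Z _) morph_incl_excl; last exact: raddfB.
rewrite [X in _ = Posz X](eq_card (B := [pred x : 'rV['F_p]_n | (x <= capker [::])%MS &&
    avoids [seq map_mx (intr : int -> 'F_p) a | a <- A] x])); last first.
  by move=> x; rewrite !inE sub_capker.
rewrite card_avoids card_Fp //.
rewrite (incl_excl_map (map_mx (intr : int -> 'F_p)) _ A [::]) -[RHS](NP p p_pr pN).
apply: (eq_in_incl_excl (U := A)) => // u _.
by rewrite /= /horner_eval hornerXn /gR -[RHS]natz natrX natz.
Qed.

(** Otherwise P - Q would have as many distinct roots as its size, which exceeds its degree. The
    primes are chosen one by one, each above [N] and above those already chosen. *)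
Lemma poly_eq_at_primes (P Q : {poly int}) :
  (exists N : nat, forall p, prime p -> (N < p)%N -> P.[p%:Z] = Q.[p%:Z]) -> P = Q.
Proof.
move=> [N NP]; apply/eqP; rewrite -subr_eq0; apply/negPn/negP => PQ0.
have [s [s_size s_uniq s_big]] : exists s : seq nat,
    [/\ size s = size (P - Q), uniq s & {in s, forall p, prime p && (N < p)%N}].
  elim: (size _) => [|k [s [ss us sP]]]; first by exists [::].
  have [p + p_pr] := prime_above (maxn N (\max_(q <- s) q)).
  rewrite gtn_max => /andP[Np sp]; exists (p :: s); split; rewrite /= ?ss //.
    rewrite us andbT; apply: contraL sp => ps; rewrite -leqNgt.
    exact: (leq_bigmax_seq (F := id)).
  by move=> q; rewrite inE => /orP[/eqP->|/sP//]; rewrite p_pr.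
have := max_poly_roots (rs := [seq p%:Z | p <- s]) PQ0; rewrite size_map s_size ltnn.
have -> : all (root (P - Q)) [seq p%:Z | p <- s].
  apply/allP => _ /mapP[p /s_big/andP[pp pN] ->].
  by rewrite rootE !hornerE NP // subrr.
have -> : uniq [seq p%:Z | p <- s] by rewrite map_inj_uniq // => x y [].
by move=> /(_ isT isT).
Qed.

(** * Counting tuples with distinct, or distinct up to sign, entries *)

Lemma card_tupleS (T : finType) n (P : pred (seq T)) :
  #|[pred t : n.+1.-tuple T | P t]| = (\sum_(t : n.-tuple T) #|[pred a | P (a :: t)]|)%N.
Proof.
rewrite -sum1_card (reindex (fun q : n.-tuple T * T => [tuple of q.2 :: q.1])) /=; last first.
  exists (fun t : n.+1.-tuple T => ([tuple of behead t], thead t)) => [[t a] _|t _] /=.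
    by congr (_, _); apply: val_inj.
  by rewrite [RHS]tuple_eta; apply: val_inj.
under [RHS]eq_bigr do rewrite -sum1_card.
by rewrite pair_big_dep.
Qed.

Lemma card_predtuple (T : finType) n (P : pred (seq T)) :
  #|[pred t : n.-tuple T | P t]| = (\sum_(t : n.-tuple T) P t)%N.
Proof.
by rewrite -sum1_card big_mkcond /=; apply: eq_bigr => t _; rewrite inE; case: (P t).
Qed.

(** A tail in [Q] admits all heads but [c], and a tail in [B] one head more. The hypothesis is
    additive because subtraction on naturals truncates. *)
Lemma card_tupleS_forbid2 (T : finType) n (P Q B : pred (seq T)) (c : nat) :
    (forall t : n.-tuple T, #|[pred a | P (a :: t)]| + c * Q t = B t + #|T| * Q t)%N ->
  #|[pred t : n.+1.-tuple T | P t]|%:Z =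
  (#|[pred t : n.-tuple T | B t]|%:Z +
   #|[pred t : n.-tuple T | Q t]|%:Z * (#|T|%:Z - c%:Z))%R.
Proof.
move=> H; rewrite mulrBr addrA; apply/eqP; rewrite -subr_eq opprK -!PoszM -!PoszD eqz_nat.
rewrite card_tupleS !card_predtuple !big_distrl -!big_split /=; apply/eqP/eq_bigr => t _.
by rewrite ![(Q t * _)%N]mulnC H.
Qed.

Lemma card_tupleS_forbid (T : finType) n (P Q : pred (seq T)) (c : nat) :
    (forall t : n.-tuple T, #|[pred a | P (a :: t)]| + c * Q t = #|T| * Q t)%N ->
  #|[pred t : n.+1.-tuple T | P t]|%:Z =
  (#|[pred t : n.-tuple T | Q t]|%:Z * (#|T|%:Z - c%:Z))%R.
Proof.
move=> H; rewrite (@card_tupleS_forbid2 _ _ P Q xpred0 c); first by rewrite eq_card0 ?add0r.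
by move=> t; rewrite H.
Qed.

Lemma card_uniq_tuple (T : finType) n :
  #|[pred t : n.-tuple T | uniq t]|%:Z = \prod_(i < n) (#|T|%:Z - i%:Z).
Proof.
elim: n => [|n IH].
  by rewrite big_ord0 (eq_card (B := predT)) ?card_tuple // => t; rewrite !inE tuple0.
rewrite big_ord_recr -IH; apply: (@card_tupleS_forbid _ _ uniq uniq) => t /=.
have [ut|] := boolP (uniq t); last first.
  by rewrite !muln0 addn0 => _; apply: eq_card0 => a; rewrite !inE andbF.
rewrite !muln1 -(cardC (mem t)) addnC; congr (_ + _)%N.
  by rewrite (card_uniqP ut) size_tuple.
by apply: eq_card => a; rewrite !inE andbT.
Qed.

Definition sdistinct (F : finFieldType) : rel F := fun x y => (x != y) && (x != - y).

Lemma mem_signed (F : fieldType) (s : seq F) a :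
  (a \in s ++ map -%R s) = (a \in s) || (- a \in s).
Proof. by rewrite mem_cat -{2}[a]opprK (mem_map (@oppr_inj _)). Qed.

Lemma all_sdistinct (F : finFieldType) (s : seq F) a :
  all (sdistinct a) s = (a \notin s ++ map -%R s).
Proof.
rewrite mem_signed; elim: s => //= b s ->; rewrite !inE /sdistinct !negb_or eqr_oppLR.
by rewrite !andbA; congr (_ && _); rewrite andbAC.
Qed.

(** A nonzero element differs from its opposite when 2 is invertible. These 2n+1 distinct values are
    the ones that a new nonzero coordinate has to avoid. *)
Lemma uniq_signed (F : finFieldType) (s : seq F) : (2%:R : F) != 0 ->
  pairwise (@sdistinct F) s -> 0 \notin s -> uniq (0 :: s ++ map -%R s).
Proof.
move=> F2; elim: s => //= a s IH /andP[].
rewrite all_sdistinct inE negb_or => a_s s_pw /andP[a0 s0].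
have /= /andP[zs us] := IH s_pw s0.
have pe : perm_eq (0 :: a :: s ++ - a :: map -%R s) (0 :: a :: - a :: (s ++ map -%R s)).
  by rewrite !perm_cons -cat1s perm_catCA.
apply: (etrans (perm_uniq pe)); rewrite /= !inE !negb_or us a_s zs ?a0 ?andbT.
rewrite eq_sym oppr_eq0 eq_sym a0 !andbT /=.
have -> : - a \notin s ++ map -%R s by move: a_s; rewrite !mem_signed opprK orbC.
rewrite andbT; apply: contra F2 => /eqP aN.
have : a * 2%:R == 0 by rewrite mulr_natr mulr2n {2}aN subrr.
by rewrite mulf_eq0 eq_sym (negPf a0).
Qed.

Lemma card_sdistinct_nz (F : finFieldType) n : (2%:R : F) != 0 ->
  #|[pred t : n.-tuple F | pairwise (@sdistinct F) t && (0 \notin t)]|%:Z =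
  \prod_(i < n) (#|F|%:Z - (2 * i).+1%:Z).
Proof.
move=> F2; elim: n => [|n IH].
  by rewrite big_ord0 (eq_card (B := predT)) ?card_tuple // => t; rewrite !inE tuple0.
pose P (s : seq F) := pairwise (@sdistinct F) s && (0 \notin s).
rewrite big_ord_recr -IH; apply: (@card_tupleS_forbid _ _ P P) => t; rewrite /P /=.
have [/andP[pt t0]|Pt] := boolP (_ && _); last first.
  rewrite !muln0 addn0; apply: eq_card0 => a; rewrite !inE; apply: contraNF Pt.
  by rewrite negb_or => /andP[/andP[_ ->] /andP[_ ->]].
have us := uniq_signed F2 pt t0.
rewrite !muln1 -(cardC (mem (0 :: t ++ map -%R t))) addnC; congr (_ + _)%N.
  by rewrite (card_uniqP us) /= size_cat size_map size_tuple mul2n addnn.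
apply: eq_card => a.
by rewrite !inE !negb_or pt t0 !andbT all_sdistinct [0 == a]eq_sym andbC.
Qed.

(** Zero occupies one of n positions, and the other n-1 entries form a zero-free tuple. The
    induction adds a head: either it is the zero, or the tail already contains it. *)
Lemma card_sdistinct_z (F : finFieldType) n : (2%:R : F) != 0 ->
  #|[pred t : n.-tuple F | pairwise (@sdistinct F) t && (0 \in t)]|%:Z =
  n%:Z * \prod_(i < n.-1) (#|F|%:Z - (2 * i).+1%:Z).
Proof.
move=> F2; pose P (s : seq F) := pairwise (@sdistinct F) s && (0 \in s).
pose B (s : seq F) := pairwise (@sdistinct F) s && (0 \notin s).
elim: n => [|n IH].
  by rewrite mul0r eq_card0 // => t; rewrite !inE tuple0.
(* A tail of length n containing zero forbids 0 and plus or minus its n-1 other entries, hence 2n-1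
   values; for n = 0 there is no such tail. *)
rewrite (@card_tupleS_forbid2 _ _ P P B (2 * n).-1).
  rewrite -[RHS]/(_ * \prod_(i < n) _) IH card_sdistinct_nz //.
  case: n {IH} => [|n]; first by rewrite !big_ord0 !mul0r addr0.
  have -> : (2 * n.+1).-1 = (2 * n).+1 by lia.
  by rewrite big_ord_recr /= (intS n.+1); ring.
move=> t; rewrite /P /B /=.
have [pt|pt] := boolP (pairwise _ t); last first.
  by rewrite !muln0 addn0; apply: eq_card0 => a; rewrite !inE andbF.
have [t0|t0] := boolP (0 \in t); last first.
  rewrite !muln0 !addn0 /= -(card1 (0 : F)); apply: eq_card => a.
  rewrite !inE (negPf t0) orbF ?pt andbT [0 == a]eq_sym all_sdistinct.
  have [->|] := eqVneq a 0; last by rewrite andbF.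
  by rewrite mem_signed oppr0 (negPf t0).
have ut : uniq t.
  by rewrite uniq_pairwise; apply: sub_pairwise pt => x y /andP[].
(* Removing the zero leaves a tuple to which [uniq_signed] applies. *)
pose u := rem 0 t; have u0 : 0 \notin u by rewrite mem_rem_uniq // !inE eqxx.
have pu : pairwise (@sdistinct F) u by rewrite /u rem_filter // pairwise_filter.
have us := uniq_signed F2 pu u0.
rewrite !muln1 add0n -(cardC (mem (0 :: u ++ map -%R u))) addnC; congr (_ + _)%N.
  rewrite (card_uniqP us) /= size_cat size_map size_rem // size_tuple.
  have : (0 < size t)%N by rewrite -has_predT; apply/hasP; exists 0.
  by rewrite size_tuple; lia.
apply: eq_card => a; rewrite !inE ?pt t0 orbT !andbT all_sdistinct; congr (~~ _).
rewrite mem_signed mem_signed !mem_rem_uniq // !inE oppr_eq0.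
by have [->|] := eqVneq a 0; rewrite ?t0.
Qed.

(** Tuples without and with a zero share the product of the q - (2i+1), i < n. The remaining factors
    add up to (q - (2n+1)) + (n+1) = q - n, with q the size of [F]. *)
Lemma card_sdistinct (F : finFieldType) n : (2%:R : F) != 0 ->
  #|[pred t : n.+1.-tuple F | pairwise (@sdistinct F) t]|%:Z =
  (\prod_(i < n) (#|F|%:Z - (2 * i).+1%:Z)) * (#|F|%:Z - n%:Z).
Proof.
move=> F2; rewrite -(cardID [pred t : n.+1.-tuple F | 0 \in t]) PoszD.
have -> : #|[predI [pred t : n.+1.-tuple F | pairwise (@sdistinct F) t] &
              [pred t : n.+1.-tuple F | 0 \in t]]| =
    #|[pred t : n.+1.-tuple F | pairwise (@sdistinct F) t && (0 \in t)]|.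
  by apply: eq_card => t; rewrite !inE.
have -> : #|[predD [pred t : n.+1.-tuple F | pairwise (@sdistinct F) t] &
              [pred t : n.+1.-tuple F | 0 \in t]]| =
    #|[pred t : n.+1.-tuple F | pairwise (@sdistinct F) t && (0 \notin t)]|.
  by apply: eq_card => t; rewrite !inE andbC.
rewrite card_sdistinct_z // card_sdistinct_nz // big_ord_recr /=.
have -> : n.+1%:Z = n%:Z + 1 by lia.
have -> : (2 * n).+1%:Z = n%:Z + n%:Z + 1 by lia.
by ring.
Qed.

(** * The three arrangements over any ring and their characteristic polynomials *)

(** The same lists as [arrA], [arrD], [arrB], but over any ring, so that one integral arrangement
    maps both to the reals and to a prime field. *)
Definition rootsA (R : nzRingType) n : seq 'rV[R]_n :=
  [seq delta_mx 0 i - delta_mx 0 j | i : 'I_n <- enum 'I_n,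
     j : 'I_n <- seq.filter (fun j : 'I_n => (i < j)%N) (enum 'I_n)].
Definition rootsD (R : nzRingType) n : seq 'rV[R]_n :=
  rootsA R n ++ [seq delta_mx 0 i + delta_mx 0 j | i : 'I_n <- enum 'I_n,
     j : 'I_n <- seq.filter (fun j : 'I_n => (i < j)%N) (enum 'I_n)].
Definition rootsB (R : nzRingType) n : seq 'rV[R]_n :=
  rootsD R n ++ [seq delta_mx 0 k | k <- enum 'I_n].

Lemma map_rootsA (R S : nzRingType) (f : {rmorphism R -> S}) n :
  [seq map_mx f a | a <- rootsA R n] = rootsA S n.
Proof.
rewrite map_allpairs; apply: eq_allpairs => i j.
by rewrite map_mxB !map_delta_mx.
Qed.

Lemma map_rootsD (R S : nzRingType) (f : {rmorphism R -> S}) n :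
  [seq map_mx f a | a <- rootsD R n] = rootsD S n.
Proof.
rewrite map_cat map_rootsA; congr (_ ++ _); rewrite map_allpairs.
by apply: eq_allpairs => i j; rewrite map_mxD !map_delta_mx.
Qed.

Lemma map_rootsB (R S : nzRingType) (f : {rmorphism R -> S}) n :
  [seq map_mx f a | a <- rootsB R n] = rootsB S n.
Proof.
rewrite map_cat map_rootsD; congr (_ ++ _); rewrite -map_comp.
by apply: eq_map => i /=; rewrite map_delta_mx.
Qed.

(** Since [enum 'I_n] is increasing, pairs i < j are pairs of successive positions in the coordinate
    list. *)
Lemma all_ordered_pairs (T V : Type) n (g : 'I_n -> 'I_n -> V) (P : pred V) (r : rel T)
    (f : 'I_n -> T) : (forall i j, P (g i j) = r (f i) (f j)) ->
  all P [seq g i j | i <- enum 'I_n, j <- seq.filter (fun j : 'I_n => (i < j)%N) (enum 'I_n)] =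
  pairwise r [seq f i | i <- enum 'I_n].
Proof.
move=> Pgr; rewrite pairwise_map; apply/idP/idP.
  case: n g f Pgr => [|n] g f Pgr; first by rewrite (size0nil (size_enum_ord 0)).
  move=> /all_allpairsP H; apply/(pairwiseP ord0) => i j.
  rewrite !inE !size_enum_ord => i_n j_n ij; rewrite /= -Pgr.
  apply: H; first by rewrite mem_nth ?size_enum_ord.
  by rewrite mem_filter mem_nth ?size_enum_ord // !nth_enum_ord ?ij.
case: n g f Pgr => [|n] g f Pgr; first by rewrite (size0nil (size_enum_ord 0)).
move=> /(pairwiseP ord0) H; apply/all_allpairsP => i j _.
rewrite mem_filter => /andP[ij _]; rewrite Pgr.
have := H i j; rewrite !inE size_enum_ord !ltn_ord => /(_ isT isT ij).
by rewrite /= !nth_ord_enum.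
Qed.

Lemma mulmx_tr_delta (F : nzRingType) n (x : 'rV[F]_n) (i : 'I_n) :
  x *m (delta_mx 0 i)^T = (x 0 i)%:M.
Proof. by rewrite trmx_delta -colE [LHS]mx11_scalar mxE. Qed.

Lemma scalar_mx1_eq0 (F : nzRingType) (c : F) : ((c%:M : 'M[F]_1) == 0) = (c == 0).
Proof.
apply/eqP/eqP => [/matrixP/(_ 0 0)|->]; last by rewrite raddf0.
by rewrite !mxE eqxx mulr1n.
Qed.

Lemma avoids_rootsA (F : fieldType) n (x : 'rV[F]_n) :
  avoids (rootsA F n) x = uniq [seq x 0 i | i <- enum 'I_n].
Proof.
rewrite uniq_pairwise; apply: all_ordered_pairs => i j.
by rewrite linearB mulmxBr !mulmx_tr_delta -raddfB scalar_mx1_eq0 subr_eq0.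
Qed.

Lemma avoids_rootsD (F : finFieldType) n (x : 'rV[F]_n) :
  avoids (rootsD F n) x = pairwise (@sdistinct F) [seq x 0 i | i <- enum 'I_n].
Proof.
rewrite /avoids all_cat [X in X && _]avoids_rootsA uniq_pairwise pairwise_relI.
congr (_ && _); apply: all_ordered_pairs => i j.
by rewrite linearD mulmxDr !mulmx_tr_delta -raddfD scalar_mx1_eq0 addr_eq0.
Qed.

Lemma avoids_rootsB (F : finFieldType) n (x : 'rV[F]_n) :
  avoids (rootsB F n) x =
  pairwise (@sdistinct F) [seq x 0 i | i <- enum 'I_n] && (0 \notin [seq x 0 i | i <- enum 'I_n]).
Proof.
rewrite /avoids all_cat [X in X && _]avoids_rootsD; congr (_ && _).
rewrite all_map -has_pred1 has_map -all_predC; apply: eq_all => i /=.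
by rewrite mulmx_tr_delta scalar_mx1_eq0.
Qed.

Lemma card_row_tuple (T : finType) n (P : pred (seq T)) :
  #|[pred x : 'rV[T]_n | P [seq x 0 i | i <- enum 'I_n]]| = #|[pred t : n.-tuple T | P t]|.
Proof.
rewrite -!sum1_card.
rewrite (reindex (fun t : n.-tuple T => \row_i tnth t i)); last first.
  exists (fun x : 'rV[T]_n => [tuple x 0 i | i < n]) => [t _|x _].
    by apply: eq_from_tnth => i; rewrite tnth_mktuple mxE.
  by apply/rowP => i; rewrite mxE tnth_mktuple.
apply: eq_bigl => t; rewrite !inE; congr P.
by rewrite -[RHS]map_tnth_enum; apply: eq_map => i; rewrite mxE.
Qed.

Lemma charpolyE (R : numFieldType) n (A : seq 'rV[int]_n) (Q : {poly int})
    (P : forall F : finFieldType, pred (seq F)) :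
    (forall (F : finFieldType) (x : 'rV[F]_n),
      avoids [seq map_mx (intr : int -> F) a | a <- A] x = P F [seq x 0 i | i <- enum 'I_n]) ->
    (forall F : finFieldType, (2%:R : F) != 0 ->
      #|[pred t : n.-tuple F | P F t]|%:Z = Q.[#|F|%:Z]) ->
  charpoly R A = Q.
Proof.
move=> AP PQ; apply: poly_eq_at_primes; have [N NP] := horner_charpoly R A.
(* Primes above 2 keep 2 nonzero, as the type B and D counts require. *)
exists (maxn N 2) => p pp; rewrite gtn_max => /andP[Np p2].
rewrite NP // -[X in Q.[X%:Z]](card_Fp pp) -PQ ?(@intr_Fp_neq0 p 2) //.
by rewrite -card_row_tuple; congr Posz; apply: eq_card => x; rewrite !inE AP.
Qed.

Lemma charpoly_rootsA (R : numFieldType) n :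
  charpoly R (rootsA int n) = \prod_(i < n) ('X - (i%:Z)%:P).
Proof.
apply: (@charpolyE _ _ _ _ (fun F => @uniq F)) => [F x|F _].
  by rewrite map_rootsA avoids_rootsA.
by rewrite card_uniq_tuple horner_prod; apply: eq_bigr => i _; rewrite !hornerE.
Qed.

Lemma charpoly_rootsB (R : numFieldType) n :
  charpoly R (rootsB int n) = \prod_(i < n) ('X - ((2 * i).+1%:Z)%:P).
Proof.
apply: (@charpolyE _ _ _ _ (fun F s => pairwise (@sdistinct F) s && (0 \notin s))) => [F x|F F2].
  by rewrite map_rootsB avoids_rootsB.
by rewrite card_sdistinct_nz // horner_prod; apply: eq_bigr => i _; rewrite !hornerE.
Qed.

Lemma charpoly_rootsD (R : numFieldType) n :
  charpoly R (rootsD int n.+1) =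
  (\prod_(i < n) ('X - ((2 * i).+1%:Z)%:P)) * ('X - (n%:Z)%:P).
Proof.
apply: (@charpolyE _ _ _ _ (fun F => pairwise (@sdistinct F))) => [F x|F F2].
  by rewrite map_rootsD avoids_rootsD.
rewrite card_sdistinct // hornerM horner_prod !hornerE; congr (_ * _).
by apply: eq_bigr => i _; rewrite !hornerE.
Qed.

(** * Sign patterns realized on a subspace, by deletion and restriction *)

Definition dotv (R : nzRingType) n (a x : 'rV[R]_n) : R := (x *m a^T) 0 0.

Lemma dotvD (R : nzRingType) n (a x y : 'rV[R]_n) : dotv a (x + y) = dotv a x + dotv a y.
Proof. by rewrite /dotv mulmxDl mxE. Qed.

Lemma dotvZ (R : nzRingType) n (a x : 'rV[R]_n) (c : R) : dotv a (c *: x) = c * dotv a x.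
Proof. by rewrite /dotv -scalemxAl mxE. Qed.

Lemma dotv_eq0 (R : nzRingType) n (a x : 'rV[R]_n) : (x *m a^T == 0) = (dotv a x == 0).
Proof. by rewrite [x *m a^T]mx11_scalar scalar_mx1_eq0. Qed.

Lemma avoidsE (F : fieldType) n (A : seq 'rV[F]_n) (x : 'rV[F]_n) :
  avoids A x = all (fun a => dotv a x != 0) A.
Proof. by apply: eq_all => a; rewrite dotv_eq0. Qed.

Definition signs (R : realFieldType) n (A : seq 'rV[R]_n) (x : 'rV[R]_n) : seq bool :=
  [seq 0 < dotv a x | a <- A].

(** Positivity of products is the form of sign agreement that can be estimated under perturbation
    and along segments; it also forces [y] off the hyperplanes. *)
Lemma signs_eqP (R : realFieldType) n (A : seq 'rV[R]_n) (x y : 'rV[R]_n) : avoids A x ->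
  reflect (avoids A y /\ signs A y = signs A x) (all (fun a => 0 < dotv a x * dotv a y) A).
Proof.
rewrite !avoidsE; elim: A => [|a A IH] /=; first by constructor.
move=> /andP[ax Ax]; apply: (iffP andP) => [[xy /(IH Ax)[-> ->]]|[/andP[ay Ay] [s sA]]].
  have /andP[-> _] : (dotv a y != 0) && true.
    by rewrite andbT; apply: contraTN xy => /eqP->; rewrite mulr0 ltxx.
  split=> //; congr (_ :: _); apply/idP/idP => p; first by rewrite pmulr_lgt0 in xy.
  by rewrite pmulr_rgt0 in xy.
split; last by apply/(IH Ax).
case: (ltgtP 0 (dotv a x)) s ax => // [px|nx] s _; last first.
  by rewrite nmulr_rgt0 // lt_neqAle ay leNgt s.
by rewrite pmulr_rgt0 // s.
Qed.

Lemma signs_perturb (R : realFieldType) n (A : seq 'rV[R]_n) (x v : 'rV[R]_n) : avoids A x ->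
  exists2 e : R, 0 < e & forall c, `|c| <= e ->
    avoids A (x + c *: v) /\ signs A (x + c *: v) = signs A x.
Proof.
move=> Ax; suff [e e0 eP] : exists2 e : R, 0 < e & forall c, `|c| <= e ->
    all (fun a => 0 < dotv a x * dotv a (x + c *: v)) A.
  by exists e => // c /eP /(signs_eqP _ Ax).
move: Ax; rewrite avoidsE; elim: A => [|a A IH] /=; first by exists 1.
move=> /andP[ax /IH[e e0 eP]].
have ax0 : 0 < `|dotv a x| by rewrite normr_gt0.
have av1 : 0 < 1 + `|dotv a v| by rewrite ltr_pwDl.
(* This bound gives |c (a, v)| < |(a, x)|, so the sign at [a] cannot change; the added 1 keeps the
   denominator positive. *)
exists (Num.min e (`|dotv a x| / (1 + `|dotv a v|))).
  by rewrite lt_min e0 divr_gt0.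
move=> c; rewrite le_min => /andP[/eP-> ce]; rewrite andbT dotvD dotvZ.
have cv : `|c * dotv a v| < `|dotv a x|.
  have [c0|c0] := eqVneq c 0; first by rewrite c0 mul0r normr0.
  rewrite normrM; apply: (@lt_le_trans _ _ (`|c| * (1 + `|dotv a v|))).
    by rewrite ltr_pM2l ?normr_gt0 // ltrDr.
  by rewrite -ler_pdivlMr.
rewrite mulrDr -expr2 -real_normK ?num_real // expr2.
have : `|dotv a x * (c * dotv a v)| < `|dotv a x| * `|dotv a x| by rewrite normrM ltr_pM2l.
by rewrite ltr_norml => /andP[h _]; rewrite -ltrBlDl sub0r; lra.
Qed.

Definition hit (R : realFieldType) n (A : seq 'rV[R]_n) (L : 'M[R]_n) : pred (seq bool) :=
  fun t => `[< exists x : 'rV[R]_n, [/\ (x <= L)%MS, avoids A x & signs A x = t] >].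

Definition nhits (R : realFieldType) n (A : seq 'rV[R]_n) (L : 'M[R]_n) : nat :=
  #|[pred t : (size A).-tuple bool | hit A L t]|.

Lemma eq_nhits (R : realFieldType) n (A : seq 'rV[R]_n) (L M : 'M[R]_n) :
  (L :=: M)%MS -> nhits A L = nhits A M.
Proof.
move=> LM; apply: eq_card => t; rewrite !inE.
by apply/asboolP/asboolP => -[x [xL xA xt]]; exists x; rewrite ?LM // -LM.
Qed.

Lemma exists_dotv_neq0 (R : fieldType) n (a : 'rV[R]_n) (L : 'M[R]_n) :
  ~~ (L <= kermx a^T)%MS -> exists2 v : 'rV[R]_n, (v <= L)%MS & dotv a v != 0.
Proof.
move=> /row_subPn[i]; rewrite sub_kermx dotv_eq0 => h; exists (row i L) => //.
exact: row_sub.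
Qed.

(* By perturbation, a pattern realized on L is realized off the hyperplane of a, on at
   least one side; by convexity and perturbation, it is realized on both sides exactly
   when it is realized on the hyperplane. *)
Lemma hit_or (R : realFieldType) n (a : 'rV[R]_n) (A : seq 'rV[R]_n) (L : 'M[R]_n) t :
    ~~ (L <= kermx a^T)%MS ->
  hit (a :: A) L (true :: t) || hit (a :: A) L (false :: t) = hit A L t.
Proof.
move=> /exists_dotv_neq0[v vL va]; apply/orP/asboolP.
  by case=> /asboolP[x [xL /andP[_ xA] [_ xt]]]; exists x.
have hitb x : (x <= L)%MS -> avoids A x -> signs A x = t -> dotv a x != 0 ->
    hit (a :: A) L (true :: t) \/ hit (a :: A) L (false :: t).
  move=> xL xA xt xa.
  have : hit (a :: A) L ((0 < dotv a x) :: t).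
    by apply/asboolP; exists x; split; rewrite //= ?dotv_eq0 ?xa // -xt.
  by case: (0 < _); [left|right].
move=> [x [xL xA xt]]; have [xa|] := eqVneq (dotv a x) 0; last exact: hitb.
have [e e0 /(_ e)] := signs_perturb v xA; rewrite gtr0_norm // lexx => /(_ isT)[yA ys].
apply: (hitb (x + e *: v)) => //; [|by rewrite ys|].
  by rewrite addmx_sub // scalemx_sub.
by rewrite dotvD dotvZ xa add0r mulf_neq0 // gt_eqF.
Qed.

Lemma hit_and (R : realFieldType) n (a : 'rV[R]_n) (A : seq 'rV[R]_n) (L : 'M[R]_n) t :
    ~~ (L <= kermx a^T)%MS ->
  hit (a :: A) L (true :: t) && hit (a :: A) L (false :: t) = hit A (kermx a^T :&: L)%MS t.
Proof.
move=> /exists_dotv_neq0[v vL va]; apply/andP/asboolP.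
  move=> [/asboolP[x [xL /andP[_ xA] [xa xt]]] /asboolP[y [yL /andP[ya yA] [ya' yt]]]].
  have {}ya : dotv a y < 0 by rewrite lt_neqAle -dotv_eq0 ya leNgt ya'.
  have xA' : avoids A x := xA.
  (* Up to a positive factor, this is where the segment from [x] to [y] crosses the hyperplane of
     [a]: both weights are positive. *)
  exists (- dotv a y *: x + dotv a x *: y).
  have /(signs_eqP _ xA)[zA zs] :
      all (fun b => 0 < dotv b x * dotv b (- dotv a y *: x + dotv a x *: y)) A.
    have /(signs_eqP _ xA)/allP xy : avoids A y /\ signs A y = signs A x by rewrite yt.
    apply/allP => b bA; have := xy b bA; have xb : dotv b x != 0.
      by have := avoidsE A x; rewrite xA' => /esym/allP/(_ b bA).
    rewrite dotvD !dotvZ => h.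
    rewrite mulrDr mulrCA -expr2 [X in _ + X]mulrCA addr_gt0 // mulr_gt0 ?oppr_gt0 //.
    by rewrite exprn_even_gt0.
  split; rewrite // ?zs // sub_capmx sub_kermx dotv_eq0 addmx_sub ?scalemx_sub // andbT.
  by rewrite dotvD !dotvZ mulNr mulrC addNr.
move=> [x [+ xA xt]]; rewrite sub_capmx sub_kermx dotv_eq0 => /andP[/eqP xa xL].
have [e e0 eP] := signs_perturb v xA.
have H c b : `|c| <= e -> (0 < c * dotv a v) = b -> c != 0 -> hit (a :: A) L (b :: t).
  move=> /eP[yA ys] <- c0; apply/asboolP; exists (x + c *: v).
  rewrite addmx_sub ?scalemx_sub // /= dotv_eq0 dotvD dotvZ xa add0r yA mulf_neq0 //.
  by rewrite ys xt.
(* The sign of (a, v) decides which of the steps e and -e along [v] lands on which side. *)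
case: (ltgtP 0 (dotv a v)) va => // va _; [split; [apply: (H e)|apply: (H (- e))]|
  split; [apply: (H (- e))|apply: (H e)]]; rewrite ?normrN ?gtr0_norm ?oppr_eq0 ?gt_eqF //.
- by rewrite pmulr_rgt0.
- by apply/negbTE; rewrite -leNgt mulNr oppr_le0 mulr_ge0 // ltW.
- by rewrite nmulr_rgt0 ?oppr_lt0.
- by apply/negbTE; rewrite -leNgt pmulr_rle0 // ltW.
Qed.

(** For truth values, p + q = (p or q) + (p and q). By [hit_or] and [hit_and] the disjunction counts
    the deletion and the conjunction the restriction. *)
Lemma nhits_cons (R : realFieldType) n (a : 'rV[R]_n) (A : seq 'rV[R]_n) (L : 'M[R]_n) :
    ~~ (L <= kermx a^T)%MS ->
  nhits (a :: A) L = (nhits A L + nhits A (kermx a^T :&: L)%MS)%N.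
Proof.
move=> La; rewrite /nhits [LHS]card_tupleS !card_predtuple -big_split /=.
apply: eq_bigr => t _; rewrite -(hit_or _ _ La) -(hit_and _ _ La).
rewrite -sum1_card big_mkcond big_bool !inE.
by case: (hit _ _ _); case: (hit _ _ _).
Qed.

Lemma nhits_cons0 (R : realFieldType) n (a : 'rV[R]_n) (A : seq 'rV[R]_n) (L : 'M[R]_n) :
  (L <= kermx a^T)%MS -> nhits (a :: A) L = 0%N.
Proof.
move=> La; apply: eq_card0 => t; rewrite !inE; apply/asboolP => -[x [xL /andP[xa _] _]].
by move: xa; rewrite -sub_kermx (submx_trans xL La).
Qed.

Lemma rank_cap_hyp (F : fieldType) n (a : 'rV[F]_n) (L : 'M[F]_n) :
  ~~ (L <= kermx a^T)%MS -> (\rank (kermx a^T :&: L)%MS).+1 = \rank L.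
Proof.
rewrite sub_kermx => La; rewrite -[RHS](mxrank_mul_ker L a^T) capmxC -[LHS]add1n; congr (_ + _)%N.
by apply/esym/eqP; rewrite eqn_leq rank_leq_col lt0n mxrank_eq0.
Qed.

(* Whitney's formula for the arrangement induced on L, by deletion and restriction. *)
Lemma nhits_incl_excl (R : realFieldType) n (L : 'M[R]_n) (A s : seq 'rV[R]_n) :
  (nhits A (L :&: capker s)%MS)%:Z = (-1) ^+ \rank (L :&: capker s)%MS *
    incl_excl (fun u => (-1) ^+ \rank (L :&: capker u)%MS) A s.
Proof.
elim: A s => [|a A IH] s /=.
  rewrite -signr_odd -expr2 sqrr_sign /nhits (eq_card (B := predT)) ?card_tuple //.
  move=> t; rewrite !inE; apply/asboolP; exists 0; split; rewrite ?sub0mx //=.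
  by rewrite (tuple0 t).
have capE : (L :&: capker (a :: s) :=: kermx a^T :&: (L :&: capker s))%MS.
  apply/eqmxP/rV_eqP => x; rewrite capker_cons !sub_capmx.
  by case: (x <= L)%MS; rewrite ?andbF.
(* If the flat lies in the hyperplane of [a], no pattern is realized, and the two
   inclusion-exclusion terms are equal and cancel. *)
have [sa|sa] := boolP (L :&: capker s <= kermx a^T)%MS.
  rewrite nhits_cons0 //; have : (L :&: capker (a :: s) :=: L :&: capker s)%MS.
    by apply: eqmx_trans capE _; apply/capmx_idPr.
  move=> E; have H := IH (a :: s); rewrite (eq_nhits _ E) E IH in H.
  have /mulfI/(_ _ _ H) -> : (-1) ^+ \rank (L :&: capker s)%MS != 0 :> int.
    by rewrite signr_eq0.
  by rewrite subrr mulr0.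
rewrite (nhits_cons _ sa) -(eq_nhits _ capE) PoszD !IH.
(* Restriction lowers the rank by one, which turns the minus sign of [incl_excl] into a plus. *)
rewrite -(rank_cap_hyp sa) -capE exprS mulN1r mulrBr !mulNr opprK addrC; congr (_ + _).
Qed.

(** * General position and the alternating tail *)

(* Truncated subtraction covers both cases of the definition of general position. *)
Lemma general_position_rank (R : realType) n (A : seq 'rV[R]_n) d (L : 'M[R]_n) (u : seq 'rV[R]_n) :
    (d <= n)%N -> \rank L = (n - d)%N -> general_position A d L -> {subset u <= A} ->
  \rank (L :&: capker u)%MS = (\rank (capker u) - d)%N.
Proof.
(* The empty list is treated apart, since [general_position] speaks of nonempty subsets only. *)
move=> dn rL gp uA; have [->|[a au]] : u = [::] \/ exists a, a \in u.
  by case: u {uA} => [|a u]; [left|right; exists a; rewrite mem_head].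
  rewrite /capker big_nil mxrank1 -rL; apply/eqmx_rank/eqmxP/capmx_idPl.
  by rewrite submx1.
pose B : {set 'I_(size A)} := finset (fun i => tnth (in_tuple A) i \in u).
have capB : (capmx_sub B :=: capker u)%MS.
  apply/eqmxP/rV_eqP => x; rewrite sub_capker; apply/sub_bigcapmxP/allP => [H b bu|H i].
    have /(tnthP (in_tuple A))[i bi] := uA b bu.
    by rewrite -sub_kermx bi; apply: H; rewrite finset.in_set -bi.
  by rewrite finset.in_set => /H; rewrite /hypmx sub_kermx.
have B0 : B != finset.set0.
  have /(tnthP (in_tuple A))[i ai] := uA a au.
  by apply/set0Pn; exists i; rewrite finset.in_set -ai.
have := gp B B0; rewrite /arr_rank capB.
have -> : \rank (L :&: capmx_sub B)%MS = \rank (L :&: capker u)%MS.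
  by rewrite (cap_eqmx (eqmx_refl L) capB).
have := rank_leq_row (capker u) => /= un ->.
by case: ifP => //; lia.
Qed.

(** The left side is the image of the polynomial under the linear functional sending X^k to
    [c k]. *)
Lemma incl_excl_coef (T : Type) (h : seq T -> nat) (c : nat -> int) (A s : seq T) m :
    (forall u, (h u <= m)%N) ->
  incl_excl (fun u => c (h u)) A s =
  \sum_(k < m.+1) (incl_excl (fun u => 'X^(h u)) A s)`_k * c k.
Proof.
move=> hm; pose f (P : {poly int}) := \sum_(k < m.+1) P`_k * c k.
rewrite -[RHS]/(f _) morph_incl_excl.
  apply: eq_incl_excl => u; rewrite /= /f (bigD1 (Ordinal (hm u : h u < m.+1)%N)) //=.
  rewrite coefXn eqxx mul1r big1 ?addr0 // => k.
  by rewrite -val_eqE /= coefXn => /negPf->; rewrite mul0r.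
by move=> P Q; rewrite /f -sumrB; apply: eq_bigr => k _; rewrite coefB mulrBl.
Qed.

Definition coef_prod (cs : seq nat) (k : nat) : nat :=
  nth 0%N (\prod_(c <- cs) ('X + (c%:R)%:P) : {poly nat})%R k.

(** Coefficientwise form of the substitution of -X for X, which turns each X - c into -(X + c). *)
Lemma coef_prod_XaddC (cs : seq nat) k :
  (\prod_(c <- cs) ('X - (c%:Z)%:P))`_k * (-1) ^+ k =
  (-1) ^+ size cs * (coef_prod cs k)%:Z.
Proof.
rewrite /coef_prod; elim: cs k => [|c cs IH] k.
  by rewrite !big_nil !coef1; case: k => [|k] //=; rewrite mul0r mulr0.
rewrite !big_cons mulrBl mulrDl coefB coefD !coefXM !coefCM mulrBl -mulrA IH /=.
rewrite natn PoszD PoszM [(-1) ^+ (size cs).+1]exprS.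
move: ((-1) ^+ size cs) (nth _ _ k)%:Z IH => e N IH.
case: k => [|k] /=; first by rewrite mul0r; ring.
by rewrite exprS mulrCA IH; move: (nth _ _ k)%:Z => M; ring.
Qed.

Lemma signr_eq_odd (a b : nat) : odd a = odd b -> (-1) ^+ a = (-1) ^+ b :> int.
Proof. by move=> ab; rewrite -signr_odd ab signr_odd. Qed.

Lemma sum_alt_tail (f : nat -> nat) n d : (d < n)%N ->
    (forall k, (n < k)%N -> f k = 0%N) ->
  alt_tail f n d = (\sum_(k < n.+1 | (d <= k)%N && odd (k + d)) f k)%N.
Proof.
move=> dn f0; pose F k := if (d <= k)%N && odd (k + d) then f k else 0%N.
(* Two consecutive indices are added at a time, of which only the second has the right parity. The
   range ends at d + 2n, beyond n, where [f] vanishes. *)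
have step m : (\sum_(j < m) f (d + 1 + 2 * j) = \sum_(0 <= k < d + 2 * m) F k)%N.
  elim: m => [|m IH].
    rewrite big_ord0 muln0 addn0 big_nat big1 // => k /andP[_ kd].
    by rewrite /F leqNgt kd.
  have -> : (d + 2 * m.+1 = (d + 2 * m).+2)%N by lia.
  rewrite big_ord_recr IH !big_nat_recr //= -[RHS]addnA; congr (_ + _)%N.
  have -> : F (d + 2 * m)%N = 0%N by rewrite /F; case: ifP => //; lia.
  rewrite add0n /F; case: ifP => [_|]; last by lia.
  by congr f; lia.
rewrite /alt_tail step (big_cat_nat _ _ (n := n.+1)) //=; last by lia.
rewrite [X in (_ + X)%N]big_nat [X in (_ + X)%N]big1 ?addn0; last first.
  by move=> k /andP[nk _]; rewrite /F f0 //; case: ifP.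
by rewrite big_mkord [RHS]big_mkcond.
Qed.

Lemma nhits_general_position (R : realType) n d (L : 'M[R]_n) (AZ : seq 'rV[int]_n) (cs : seq nat) :
    (d < n)%N -> \rank L = (n - d)%N ->
    size cs = n -> 1%N \in cs ->
    charpoly R AZ = \prod_(c <- cs) ('X - (c%:Z)%:P) ->
    general_position [seq map_mx intr a | a <- AZ] d L ->
  nhits [seq map_mx intr a | a <- AZ] L =
  (2 * alt_tail (coef_prod cs) n d)%N.
Proof.
move=> dn rL cn c1 chi gp; pose P := coef_prod cs.
pose A : seq 'rV[R]_n := [seq map_mx intr a | a <- AZ].
have chi_size : (size (charpoly R AZ) <= n.+1)%N by rewrite chi size_prod_XsubC cn.
have chiP k : (charpoly R AZ)`_k = (-1) ^+ (n + k) * (P k)%:Z.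
  rewrite chi; have /(congr1 (fun z => z * (-1) ^+ k)) := coef_prod_XaddC cs k.
  by rewrite -mulrA -expr2 sqrr_sign mulr1 cn mulrAC -exprD.
have P0 k : (n < k)%N -> P k = 0%N.
  move=> nk; have := chiP k; rewrite nth_default ?(leq_trans chi_size) // => /esym/eqP.
  by rewrite mulf_eq0 signr_eq0 /= eqz_nat => /eqP.
(* This is chi(1) = 0, which holds because 1 is among the [cs]. *)
have Palt : \sum_(k < n.+1) (-1) ^+ (n + k) * (P k)%:Z = 0.
  transitivity (charpoly R AZ).[1].
    rewrite (horner_coef_wide _ chi_size); apply: eq_bigr => k _.
    by rewrite expr1n mulr1 chiP.
  by rewrite chi (perm_big _ (perm_to_rem c1)) big_cons hornerM hornerXsubC subrr mul0r.
have E := nhits_incl_excl L A [::].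
have L1 : (L :&: capker [::] :=: L)%MS by apply/capmx_idPl; rewrite sub_capker.
rewrite (eq_nhits _ L1) L1 rL in E.
apply/eqP; rewrite -eqz_nat {}E; apply/eqP.
rewrite (eq_in_incl_excl (U := A)
  (h := fun u => (-1) ^+ (\rank (capker u) - d))) => //; last first.
  by move=> u uA; rewrite (general_position_rank _ rL gp) // ltnW.
rewrite (incl_excl_map (map_mx (intr : int -> R)) _ AZ [::]).
rewrite [incl_excl _ _ _](incl_excl_coef (m := n) (fun k => (-1) ^+ (k - d)) AZ [::]
  (h := fun u => \rank (capker [seq map_mx (intr : int -> R) a | a <- u]))); last first.
  by move=> u; apply: rank_leq_row.
(* Subtracting (-1)^(n+d) chi(1) is chosen to cancel the terms k < d, where the truncated exponent k
   - d is 0. For k >= d it leaves 1 - (-1)^(k+d) times [P k], that is 2 or 0 times [P k] according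
   to parity. *)
have {}Palt : 0 = \sum_(k < n.+1) (-1) ^+ (n + d) * ((-1) ^+ (n + k) * (P k)%:Z).
  by rewrite -mulr_sumr Palt mulr0.
rewrite -/(charpoly R AZ) mulr_sumr -[LHS]subr0 [X in _ - X]Palt.
rewrite -sumrB (sum_alt_tail dn P0) PoszM (big_morph Posz PoszD (erefl _)) mulr_sumr.
rewrite [RHS]big_mkcond.
apply: eq_bigr => k _; rewrite /= chiP -/P.
have factor (a b c e z : int) : a * (b * z * c) - e * (b * z) = (a * b * c - e * b) * z by ring.
rewrite factor -!exprD; have [dk|kd] := leqP d k => /=; last first.
  by rewrite (@signr_eq_odd _ (n + d + (n + k))) ?subrr ?mul0r //; lia.
rewrite (@signr_eq_odd _ 0); last by lia.
case: ifP => kdo; last by rewrite (@signr_eq_odd (n + d + _) 0) ?subrr ?mul0r //; lia.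
by rewrite (@signr_eq_odd (n + d + _) 1) //; lia.
Qed.

(** * Regions as cells of constant sign pattern *)

Lemma dotv_continuous (R : realType) n (a : 'rV[R]_n) : continuous (dotv a).
Proof.
have -> : dotv a = fun y : 'rV[R]_n => \sum_j y 0 j * a 0 j.
  by apply/funext => y; rewrite /dotv mxE; apply: eq_bigr => j _; rewrite mxE.
move=> x; elim: (index_enum _) => [|j r IH].
  have -> : (fun y : 'rV[R]_n => \sum_(j <- [::]) y 0 j * a 0 j) = cst 0.
    by apply/funext => y; rewrite big_nil.
  exact: cst_continuous.
have -> : (fun y : 'rV[R]_n => \sum_(k <- j :: r) y 0 k * a 0 k) =
    (fun y => y 0 j * a 0 j + \sum_(k <- r) y 0 k * a 0 k).
  by apply/funext => y; rewrite big_cons.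
by apply: cvgD IH; apply: cvgMr_tmp; apply: coord_continuous.
Qed.

Lemma line_continuous (R : realType) n (x v : 'rV[R]_n) :
  continuous (fun t : R => x + t *: v).
Proof.
suff H (t : R) (U : set 'rV[R]_n) :
  nbhs (x + t *: v) U -> \forall s \near t, U (x + s *: v) by exact: H.
(* Neighbourhoods of a matrix are given entrywise, and finitely many entry conditions hold together
   near [t]. *)
move=> [P Pt PU]; suff : \forall s \near t, forall ij, P ij.1 ij.2 ((x + s *: v) ij.1 ij.2).
  by apply: filterS => s sP; apply: PU => i j; apply: (sP (i, j)).
apply: (@filter_forall R ('I_1 * 'I_n)%type
  (fun ij s => P ij.1 ij.2 ((x + s *: v) ij.1 ij.2)) (nbhs t)) => -[i j] /=.
suff : nbhs t (fun s => P i j ((x + s *: v) i j)) by [].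
have -> : (fun s => P i j ((x + s *: v) i j)) = (fun s => P i j (x i j + s * v i j)).
  by apply/funext => s; rewrite !mxE.
suff : {for t, continuous (fun s : R => x i j + s * v i j)}.
  by apply; have := Pt i j; rewrite !mxE.
apply: continuousD; first exact: cst_continuous.
by apply: continuousM; [move=> ?|exact: cst_continuous].
Qed.

Lemma arr_complementE (R : realType) n (A : seq 'rV[R]_n) :
  arr_complement A = [set x | avoids A x].
Proof.
apply/seteqP; split => x /= H.
  by apply/allP => a /H; rewrite /hypset /= /hypmx sub_kermx => /negP.
by move=> a aA; apply/negP; rewrite /hypmx sub_kermx; apply: (allP H).
Qed.

Definition cell (R : realType) n (A : seq 'rV[R]_n) (t : seq bool) : set 'rV[R]_n :=
  [set y | avoids A y /\ signs A y = t].

(** On a connected subset of the complement no linear form of [A] vanishes, so by the intermediate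
    value property each keeps its sign. Conversely, a segment between two points of a cell stays in
    the cell. *)
Lemma connected_component_cell (R : realType) n (A : seq 'rV[R]_n) (x : 'rV[R]_n) : avoids A x ->
  connected_component (arr_complement A) x = cell A (signs A x).
Proof.
move=> Ax; rewrite arr_complementE; apply/seteqP; split => y.
  move=> [C [Cx CA C_conn] Cy]; apply/(signs_eqP _ Ax)/allP => a aA.
  have nz z : C z -> dotv a z != 0.
    by move=> /CA /=; rewrite avoidsE => /allP; apply.
  have /connected_intervalP itvC : connected (dotv a @` C).
    apply: connected_continuous_connected => //.
    by apply: continuous_subspaceT; apply: dotv_continuous.
  rewrite ltNge; apply/negP => xy_le0; suff [z Cz /eqP] : (dotv a @` C) 0.
    by rewrite (negPf (nz z Cz)).
  have [fx0|fx0] := lerP (dotv a x) 0.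
    apply: (itvC (dotv a x) (dotv a y)); [by exists x|by exists y|].
    rewrite fx0 /=; have : dotv a x < 0 by rewrite lt_neqAle fx0 nz.
    by move=> h; move: xy_le0; rewrite nmulr_rle0.
  apply: (itvC (dotv a y) (dotv a x)); [by exists y|by exists x|].
  by rewrite (ltW fx0) andbT; move: xy_le0; rewrite pmulr_rle0.
move=> [Ay sxy]; have /allP xy : all (fun a => 0 < dotv a x * dotv a y) A.
  exact/(signs_eqP _ Ax).
exists ((fun t : R => x + t *: (y - x)) @` `[0, 1]); last first.
  exists 1; first by rewrite /= in_itv /= ler01 lexx.
  by rewrite scale1r addrC subrK.
split.
- exists 0; first by rewrite /= in_itv /= ler01 lexx.
  by rewrite scale0r addr0.
- move=> _ /= [t + <-]; rewrite /= in_itv /= => /andP[t0 t1].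
  suff /(signs_eqP _ Ax)[] : all (fun a => 0 < dotv a x * dotv a (x + t *: (y - x))) A by [].
  apply/allP => a aA; have := xy a aA; have : dotv a x != 0.
    by move: Ax; rewrite avoidsE => /allP/(_ a aA).
  rewrite -scaleN1r !(dotvD, dotvZ) => fx fxy.
  have fxx : 0 < dotv a x * dotv a x by rewrite -expr2 exprn_even_gt0.
  (* A convex combination of two positive numbers; t = 1 is treated apart because there the first
     weight vanishes. *)
  have -> : dotv a x * (dotv a x + t * (dotv a y + -1 * dotv a x)) =
    (1 - t) * (dotv a x * dotv a x) + t * (dotv a x * dotv a y) by ring.
  have [t10|t10] := ltrP t 1.
    apply: ltr_pwDl; first by rewrite mulr_gt0 // subr_gt0.
    by rewrite mulr_ge0 // ltW.
  have -> : t = 1 by apply/eqP; rewrite eq_le t1.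
  by rewrite subrr mul0r add0r mul1r.
- apply: connected_continuous_connected; first exact: segment_connected.
  by apply: continuous_subspaceT; apply: line_continuous.
Qed.

(** The realized patterns are enumerated and each index is sent to its cell. Such cells are
    nonempty, so a cell determines its pattern and the map is injective. *)
Lemma card_regions_hit (R : realType) n (A : seq 'rV[R]_n) (L : 'M[R]_n) :
  (regions_hit A L #= `I_(nhits A L))%card.
Proof.
pose s := fintype.enum [pred t : (size A).-tuple bool | hit A L t].
pose t0 := [tuple of nseq (size A) true].
have hit_s i : (i < size s)%N -> hit A L (nth t0 s i).
  by move=> /(mem_nth t0); rewrite fintype.mem_enum inE.
have -> : regions_hit A L = (fun i => cell A (nth t0 s i)) @` `I_(nhits A L).
  rewrite /nhits cardE -/s; apply/seteqP; split => C.
    move=> [[x Ax ->] [y [+ yL]]].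
    have {}Ax : avoids A x by move: Ax; rewrite arr_complementE.
    rewrite connected_component_cell // => -[Ay sy].
    pose t : (size A).-tuple bool := [tuple of [seq 0 < dotv a x | a <- in_tuple A]].
    have ts : t \in s by rewrite fintype.mem_enum inE; exists y.
    by exists (index t s); rewrite /= ?index_mem // nth_index.
  move=> [i /= /hit_s/asboolP[x [xL Ax sx]] <-]; split.
    exists x; first by rewrite arr_complementE.
    by rewrite connected_component_cell // sx.
  by exists x.
apply: inj_card_eq => i j; rewrite !inE /= => iN jN ij.
have iN' : (i < size s)%N by rewrite -cardE.
have jN' : (j < size s)%N by rewrite -cardE.
have /asboolP[x [_ Ax sx]] := hit_s i iN'.
have : cell A (nth t0 s i) x by [].
rewrite ij => -[_]; rewrite sx => /val_inj/eqP.
by rewrite nth_uniq ?fintype.enum_uniq // => /eqP.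
Qed.

(** * Assembly for the three types *)

Theorem theorem3p4 (R : realType) (n d : nat) (L : 'M[R]_n) :
  (d <= n - 1)%N -> \rank L = (n - d)%N ->
  [/\ (2 <= n)%N -> general_position (arrA R n) d L ->
        (regions_hit (arrA R n) L #= `I_(2 * alt_tail (stirling1 n) n d))%card,
      (1 <= n)%N -> general_position (arrB R n) d L ->
        (regions_hit (arrB R n) L #= `I_(2 * alt_tail (Bnum n) n d))%card
    & (2 <= n)%N -> general_position (arrD R n) d L ->
        (regions_hit (arrD R n) L #= `I_(2 * alt_tail (Dnum n) n d))%card].
Proof.
move=> dn rL.
(* [AZ] is an integral lift of the arrangement, and [cs] lists the constants c of the factors t + c
   that define the numbers [f]. *)
have count (A : seq 'rV[R]_n) (AZ : seq 'rV[int]_n) (cs : seq nat) (f : nat -> nat) :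
    (1 <= n)%N -> [seq map_mx intr a | a <- AZ] = A -> size cs = n -> 1%N \in cs ->
    charpoly R AZ = \prod_(c <- cs) ('X - (c%:Z)%:P) -> coef_prod cs =1 f ->
    general_position A d L -> (regions_hit A L #= `I_(2 * alt_tail f n d))%card.
  move=> n1 <- cn c1 chi fE gp.
  rewrite -(_ : nhits [seq map_mx intr a | a <- AZ] L = (2 * alt_tail f n d)%N).
    exact: card_regions_hit.
  rewrite (nhits_general_position _ rL cn c1 chi gp); last by lia.
  by congr (_ * _)%N; apply: eq_bigr => j _; apply: fE.
split=> n1.
- apply: (count _ (rootsA int n) (index_iota 0 n)) => //; first exact: ltnW.
  + exact: map_rootsA.
  + by rewrite size_iota subn0.
  + by rewrite mem_index_iota.
  + by rewrite charpoly_rootsA big_mkord.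
  + by move=> k; rewrite /coef_prod big_mkord.
- apply: (count _ (rootsB int n) [seq (2 * i).+1 | i <- index_iota 0 n]) => //.
  + exact: map_rootsB.
  + by rewrite size_map size_iota subn0.
  + by apply/mapP; exists 0%N; rewrite // mem_index_iota.
  + by rewrite charpoly_rootsB big_map big_mkord.
  + by move=> k; rewrite /coef_prod big_map big_mkord.
(* In type D the constants are n-1 and 1, 3, ..., 2n-3; writing n as m+2 makes visible that 1 is
   among the latter. *)
case: n n1 L dn rL count => [|[|m]] // _ L dn rL count.
apply: (count _ (rootsD int m.+2) (m.+1 :: [seq (2 * i).+1 | i <- index_iota 0 m.+1])) => //.
- exact: map_rootsD.
- by rewrite /= size_map size_iota ?subn0.
- by rewrite inE; apply/orP; right; apply/mapP; exists 0%N; rewrite // mem_index_iota.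
- by rewrite charpoly_rootsD big_cons big_map big_mkord mulrC.
by move=> k; rewrite /coef_prod big_cons big_map big_mkord mulrC.
Qed.
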